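(* Let $R$ be a commutative ring with unity and let \[S=\{\,x_0^6-2x_1^3+3x_2^2 \pmod{6R} \;:\; x_0,x_1,x_2\in R\,\}\subseteq R/6R.\] Then a matrix $M\in M_2(R)$ is a sum of sixth powers of matrices in $M_2(R)$ (i.e., $M=\sum_{i=1}^r M_i^6$ for some $r\ge1$ and $M_i\in M_2(R)$) if and only if $\operatorname{Tr} M \pmod{6R}\in S$.
   Context: $\operatorname{Tr}$ denotes the trace; $x\pmod{6R}$ denotes the image of $x\in R$ in $R/6R$. *)

(* Defs.v *)
From HB Require Import structures.
From mathcomp Require Import all_boot all_algebra.
From mathcomp Require Import boolp classical_sets.

Set Implicit Arguments.
Unset Strict Implicit.
Unset Printing Implicit Defensive.

Import GRing.Theory.
Local Open Scope ring_scope.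
Local Open Scope quotient_scope.
Local Open Scope classical_set_scope.

(* The principal ideal a R; membership is made boolean classically so that
   MathComp's quotients apply. *)
Definition principal_ideal (R : comPzRingType) (a : R) : {pred R} :=
  fun x => `[< exists y : R, x = a * y >].

Lemma principal_ideal_zmod_closed (R : comPzRingType) (a : R) :
  zmod_closed (principal_ideal a).
Proof.
split=> [|x y /asboolP [u ->] /asboolP [v ->]]; apply/asboolP.
  by exists 0; rewrite mulr0.
by exists (u - v); rewrite mulrBr.
Qed.

HB.instance Definition _ (R : comPzRingType) (a : R) :=
  GRing.isZmodClosed.Build R (principal_ideal a)
    (principal_ideal_zmod_closed a).

(* MathComp's ring structure on a quotient requires a proper ideal, whereas
   6R = R as soon as 6 is a unit; the additive quotient exists in all cases. *)
Definition quot6 (R : comPzRingType) : zmodType :=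
  {ideal_quot (principal_ideal (6 : R))}.

Definition mod6 (R : comPzRingType) (x : R) : quot6 R :=
  \pi_{ideal_quot (principal_ideal (6 : R))} x.

Definition S6 (R : comPzRingType) : set (quot6 R) :=
  [set z | exists x0 x1 x2 : R,
     z = mod6 (x0 ^+ 6 - 2 * x1 ^+ 3 + 3 * x2 ^+ 2)].
Arguments S6 R : clear implicits.

Definition sum_of_sixth_powers (R : comPzRingType) (M : 'M[R]_2) : Prop :=
  exists (r : nat) (Ms : 'I_r -> 'M[R]_2),
    (1 <= r)%N /\ M = \sum_(i < r) Ms i ^+ 6.

(* Main.v *)
(* By Cayley-Hamilton, a matrix with trace t and determinant d has
   [Tr (M^6) = t^6 - 6 t^4 d + 9 t^2 d^2 - 2 d^3].  Modulo 6 the values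
   [-2 u^3 + 3 v^2] are closed under addition and contain all
   [t^6 = -2 (t^2)^3 + 3 (t^3)^2], which gives one direction.

   Conversely, idempotents are sixth powers and -1 = J^6 with J^2 = -1, so that
   e + f - 1 is a sum of sixth powers for all idempotents e, f; these matrices
   generate all matrices of trace 0, and being a sum of sixth powers depends
   only on the trace.  The attainable traces form an additive monoid containing
   1 and, taking t = 0 and t = 1, all [-2 d^3] and [1 - 6 d + 9 d^2 - 2 d^3].
   Second differences of the cubes then yield 12 R, and hence 6 R and [3 v^2]. *)

Require Import Defs.
From mathcomp Require Import all_boot all_algebra.
From mathcomp Require Import boolp classical_sets.
From mathcomp Require Import ring.

Local Open Scope ring_scope.

Import GRing.Theory.

Section SquareMatricesOfSize2.
Variable R : comPzRingType.
Implicit Types (a b c d x y : R) (A B M : 'M[R]_2).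

Definition mx2 a b c d : 'M[R]_2 :=
  \matrix_(i, j) if i == 0 then if j == 0 then a else b
                 else if j == 0 then c else d.

Lemma mx2_eta M : M = mx2 (M 0 0) (M 0 1) (M 1 0) (M 1 1).
Proof.
apply/matrixP => -[[|[]] // i] [[|[]] // j];
  by rewrite mxE /=; congr (M _ _); apply/val_inj.
Qed.

Lemma mx2D a b c d a' b' c' d' :
  mx2 a b c d + mx2 a' b' c' d' = mx2 (a + a') (b + b') (c + c') (d + d').
Proof. by apply/matrixP => i j; rewrite !mxE; do 2?case: ifP. Qed.

Lemma mx2M a b c d a' b' c' d' :
  mx2 a b c d * mx2 a' b' c' d' =
  mx2 (a * a' + b * c') (a * b' + b * d') (c * a' + d * c') (c * b' + d * d').
Proof.
by apply/matrixP => i j; rewrite !mxE !big_ord_recl big_ord0 addr0 !mxE /=;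
  do 2?case: ifP.
Qed.

Lemma tr_mx2 a b c d : \tr (mx2 a b c d) = a + d.
Proof. by rewrite /mxtrace !big_ord_recl big_ord0 addr0 !mxE. Qed.

Lemma tr_exp6 a b c d (t := a + d) (e := a * d - b * c) :
  \tr (mx2 a b c d ^+ 6) =
  t ^+ 6 - 6 * t ^+ 4 * e + 9 * t ^+ 2 * e ^+ 2 - 2 * e ^+ 3.
Proof. by rewrite /t /e !exprS expr0 mulr1 !mx2M tr_mx2; ring. Qed.

Lemma sum_of_sixth_powers_exp6 M : sum_of_sixth_powers (M ^+ 6).
Proof. by exists 1, (fun=> M); rewrite big_ord1. Qed.

Lemma sum_of_sixth_powersD A B :
  sum_of_sixth_powers A -> sum_of_sixth_powers B -> sum_of_sixth_powers (A + B).
Proof.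
move=> [r [F [r_gt0 ->]]] [s [G [s_gt0 ->]]].
exists (r + s)%N, (fun i => match split i with inl j => F j | inr k => G k end).
split; first by rewrite addn_gt0 r_gt0.
rewrite big_split_ord; congr (_ + _); apply: eq_bigr => i _.
  by rewrite -[lshift s i]/(unsplit (inl i)) unsplitK.
by rewrite -[rshift r i]/(unsplit (inr i)) unsplitK.
Qed.

Lemma sum_of_sixth_powers_idem A : A * A = A -> sum_of_sixth_powers A.
Proof.
by move=> AA; move: (sum_of_sixth_powers_exp6 A); rewrite !exprS expr0 mulr1 !AA.
Qed.

Lemma sum_of_sixth_powers_idemDB1 A B :
  A * A = A -> B * B = B -> sum_of_sixth_powers (A + B + mx2 (-1) 0 0 (-1)).
Proof.
move=> /sum_of_sixth_powers_idem sA /sum_of_sixth_powers_idem sB.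
apply: sum_of_sixth_powersD; first exact: sum_of_sixth_powersD.
have := sum_of_sixth_powers_exp6 (mx2 0 (-1) 1 0).
by congr sum_of_sixth_powers; rewrite !exprS expr0 mulr1 !mx2M; congr mx2; ring.
Qed.

Lemma sum_of_sixth_powers_traceless a b c :
  sum_of_sixth_powers (mx2 a b c (- a)).
Proof.
have mx2_idem x y z t : x * x + y * z = x -> x * y + y * t = y ->
    z * x + t * z = z -> z * y + t * t = t ->
    mx2 x y z t * mx2 x y z t = mx2 x y z t.
  by rewrite mx2M => -> -> -> ->.
(* The three triples contribute [a + b] in the upper right corner, [c - a] in the lower left corner,
   and the matrix with both rows [(a, - a)]. *)
have -> : mx2 a b c (- a) =
    (mx2 1 (a + b) 0 0 + mx2 0 0 0 1 + mx2 (-1) 0 0 (-1)) +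
    (mx2 1 0 0 0 + mx2 0 0 (c - a) 1 + mx2 (-1) 0 0 (-1)) +
    (mx2 a (1 - a) a (1 - a) + mx2 1 (-1) 0 0 + mx2 (-1) 0 0 (-1)).
  by rewrite !mx2D; congr mx2; ring.
apply: sum_of_sixth_powersD; first apply: sum_of_sixth_powersD;
  by apply: sum_of_sixth_powers_idemDB1; apply: mx2_idem; ring.
Qed.

Lemma eq_tr_sum_of_sixth_powers A B :
  \tr A = \tr B -> sum_of_sixth_powers A -> sum_of_sixth_powers B.
Proof.
move=> eqAB sA; rewrite -(subrKC A B); apply: sum_of_sixth_powersD => //.
have tr0 : \tr (B - A) = 0 by rewrite linearB /= eqAB subrr.
rewrite (mx2_eta (B - A)) in tr0 *; rewrite tr_mx2 in tr0.
by rewrite -(addr0_eq tr0); apply: sum_of_sixth_powers_traceless.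
Qed.

(** The corner matrix represents all matrices of trace [x]. *)
Definition sixth_trace x := sum_of_sixth_powers (mx2 x 0 0 0).

Lemma sixth_trace_tr A : sum_of_sixth_powers A <-> sixth_trace (\tr A).
Proof. by split; apply: eq_tr_sum_of_sixth_powers; rewrite tr_mx2 addr0. Qed.

Lemma sixth_traceD x y :
  sixth_trace x -> sixth_trace y -> sixth_trace (x + y).
Proof.
by move=> sx sy; have := sum_of_sixth_powersD _ _ sx sy; rewrite mx2D !addr0.
Qed.

Lemma sixth_traceMn x n : sixth_trace x -> sixth_trace (x *+ n.+1).
Proof.
move=> sx; elim: n => [|n IHn]; first by rewrite mulr1n.
by rewrite mulrS; apply: sixth_traceD.
Qed.

Lemma sixth_trace_poly t d :
  sixth_trace
    (t ^+ 6 - 6 * t ^+ 4 * d + 9 * t ^+ 2 * d ^+ 2 - 2 * d ^+ 3).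
Proof.
(* The companion matrix of X^2 - t X + d has trace [t] and determinant [d]. *)
have := sum_of_sixth_powers_exp6 (mx2 0 (- d) 1 t).
by move/sixth_trace_tr; rewrite tr_exp6; congr sixth_trace; ring.
Qed.

Lemma sixth_trace_cube d : sixth_trace (- 2 * d ^+ 3).
Proof. by have := sixth_trace_poly 0 d; congr sixth_trace; ring. Qed.

Lemma sixth_trace12 x : sixth_trace (12 * x).
Proof.
(* Twice the second difference (x + 1)^3 - 2 x^3 + (x - 1)^3 = 6 x, with signs moved inside the
   cubes. *)
have -> : 12 * x = - 2 * (- x - 1) ^+ 3 + - 2 * (1 - x) ^+ 3
    + (- 2 * x ^+ 3 + - 2 * x ^+ 3) by ring.
by do 2?apply: sixth_traceD; apply: sixth_trace_cube.
Qed.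

(** From the value 1 - 6 d + 9 d^2 - 2 d^3 at [t = 1], the cube of [- d] removes the last term and
    -1 = -2 + 1 the first. *)
Lemma sixth_trace_quad d : sixth_trace (9 * d ^+ 2 - 6 * d).
Proof.
have s1 : sixth_trace (- 1).
  have := sixth_traceD _ _ (sixth_trace_cube 1) (sixth_trace_poly 1 0).
  by congr sixth_trace; ring.
have := sixth_traceD _ _ (sixth_trace_poly 1 d) (sixth_trace_cube (- d)).
by move/sixth_traceD/(_ s1); congr sixth_trace; ring.
Qed.

(* Modulo 12, three times [9 d^2 - 6 d] is its opposite; the difference of the
   values at [1 - x] and [- x] is then [6 x] up to an integer. *)
Lemma sixth_trace6 x : sixth_trace (6 * x).
Proof.
have := sixth_traceD _ _ (sixth_trace_quad (- x))
  (sixth_traceMn _ 2 (sixth_trace_quad (1 - x))).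
move/sixth_traceD/(_ (sixth_trace12 (3 * x - 3 * x ^+ 2 - 1))).
by move/sixth_traceD/(_ (sixth_trace_quad 1)); congr sixth_trace; ring.
Qed.

Lemma sixth_trace_S6 u v w :
  sixth_trace (- 2 * u ^+ 3 + 3 * v ^+ 2 + 6 * w).
Proof.
(* Modulo 6 R, 9 v^2 - 6 v agrees with 3 v^2. *)
have -> : - 2 * u ^+ 3 + 3 * v ^+ 2 + 6 * w =
    - 2 * u ^+ 3 + (9 * v ^+ 2 - 6 * v) + 6 * (w + v - v ^+ 2) by ring.
apply: sixth_traceD; last exact: sixth_trace6.
by apply: sixth_traceD; [exact: sixth_trace_cube|exact: sixth_trace_quad].
Qed.

Lemma eq_mod6 x y : mod6 x = mod6 y <-> exists w, x = y + 6 * w.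
Proof.
rewrite /mod6; split=> [/eqP|[w ->]].
  rewrite -Quotient.idealrBE => /asboolP[w xy]; exists w.
  by rewrite -xy subrKC.
apply/eqP; rewrite -Quotient.idealrBE; apply/asboolP; exists w.
by rewrite addrAC subrr add0r.
Qed.

(* The summand [x0^6] of the definition of S is redundant. *)
Lemma mod6_S6 x :
  mod6 x \in S6 R <-> exists u v w, x = - 2 * u ^+ 3 + 3 * v ^+ 2 + 6 * w.
Proof.
rewrite in_setE; split=> [[x0 [x1 [x2 /eq_mod6[w ->]]]]|[u [v [w ->]]]].
  exists (x0 ^+ 2 + x1), (x0 ^+ 3 + x2).
  exists (w + x0 ^+ 4 * x1 + x0 ^+ 2 * x1 ^+ 2 - x0 ^+ 3 * x2).
  by ring.
by exists 0, u, v; apply/eq_mod6; exists w; ring.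
Qed.

(** The cross terms of the cube and the square are multiples of 3 and 2, so the factors -2 and 3
    make them vanish modulo 6. *)
Lemma mod6_S6D x y :
  mod6 x \in S6 R -> mod6 y \in S6 R -> mod6 (x + y) \in S6 R.
Proof.
move=> /mod6_S6[u [v [w ->]]] /mod6_S6[u' [v' [w' ->]]]; apply/mod6_S6.
exists (u + u'), (v + v').
by exists (w + w' + u ^+ 2 * u' + u * u' ^+ 2 - v * v'); ring.
Qed.

Lemma mod6_tr_exp6 M : mod6 (\tr (M ^+ 6)) \in S6 R.
Proof.
rewrite (mx2_eta M) tr_exp6; set t := M 0 0 + _; set d := M 0 0 * _ - _.
(* Modulo 6, 9 t^2 d^2 becomes 3 (t d)^2 and 6 t^4 d vanishes. *)
rewrite in_setE; exists t, d, (t * d).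
by apply/eq_mod6; exists (t ^+ 2 * d ^+ 2 - t ^+ 4 * d); ring.
Qed.

End SquareMatricesOfSize2.

Theorem theorem3p3 (R : comPzRingType) (M : 'M[R]_2) :
  sum_of_sixth_powers M <-> mod6 (\tr M) \in S6 R.
Proof.
split=> [[r [Ms [_ ->]]]|/mod6_S6[u [v [w trM]]]].
  elim/big_ind: _ => [|A B|i _].
  - by apply/mod6_S6; exists 0, 0, 0; rewrite linear0; ring.
  - by rewrite linearD; apply: mod6_S6D.
  - exact: mod6_tr_exp6.
by apply/sixth_trace_tr; rewrite trM; apply: sixth_trace_S6.
Qed.
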